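(* Let $A\in\mathbb{R}^{m\times n}$ have rows $A_1,\dots,A_m$ with $\|A_i\|_2=1$ for all $i$, and let $P=\{x\in\mathbb{R}^n \mid Ax>\mathbf{0}\}$ be nonempty. Suppose $\lambda\in \mathbb{R}_{\ge 0}^m$ satisfies $\|\lambda\|_1=1$ and $\|\lambda A\|_2\le \frac{1}{12n\sqrt{\pi}}$. Then in time $O(mn^2)$ we can rescale $P$ so that $\mathrm{vol}(P\cap B)$ increases by a constant factor; that is, in time $O(mn^2)$ one can compute (from $A$ and $\lambda$) an invertible linear map $F:\mathbb{R}^n\to\mathbb{R}^n$ such that $\mathrm{vol}(F(P)\cap B)\ge c\cdot \mathrm{vol}(P\cap B)$, where $c>1$ is an absolute constant.
   Context: $B=\{x\in\mathbb{R}^n \mid \|x\|_2\le 1\}$ is the Euclidean unit ball, $\lambda A=\sum_{i=1}^m\lambda_iA_i$, and $Ax>\mathbf{0}$ is meant coordinatewise. ''Rescaling $P$'' means replacing $P$ by $F(P)$ for an invertible linear map $F$. Time is the number of elementary operations on real numbers. *)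

(* Defs.v *)
From mathcomp Require Import all_boot all_order all_algebra.
From mathcomp Require Import all_classical all_reals all_analysis.

Set Implicit Arguments.
Unset Strict Implicit.
Unset Printing Implicit Defensive.

Import Order.TTheory GRing.Theory Num.Theory.
Local Open Scope classical_set_scope.
Local Open Scope ring_scope.

(* ------------------------------ Geometry ------------------------------ *)

(* Vectors are one-row or one-column matrices; the norms are defined for all
   shapes so that both can be used.  The library norm on matrices is the sup
   norm, hence these definitions. *)
Definition norm1 (R : realType) (p q : nat) (v : 'M[R]_(p, q)) : R :=
  \sum_i \sum_j `|v i j|.

Definition norm2 (R : realType) (p q : nat) (v : 'M[R]_(p, q)) : R :=
  Num.sqrt (\sum_i \sum_j v i j ^+ 2).

Definition cone (R : realType) (m n : nat) (A : 'M[R]_(m, n)) : set 'cV[R]_n :=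
  [set x | forall i, 0 < (A *m x) i ord0].

Definition unit_ball (R : realType) (n : nat) : set 'cV[R]_n :=
  [set x | norm2 x <= 1].

Definition box (R : realType) (n : nat) (a b : 'cV[R]_n) : set 'cV[R]_n :=
  [set x | forall i, a i ord0 <= x i ord0 <= b i ord0].

(* n-dimensional Lebesgue outer measure (n > 0): the infimum of the total
   volume of countable covers by boxes.  It coincides with Lebesgue measure on
   Lebesgue measurable sets, in particular on the intersection of an open
   polyhedral cone with the closed ball. *)
Definition vol (R : realType) (n : nat) (S : set 'cV[R]_n) : \bar R :=
  ereal_inf [set v : \bar R | exists a b : nat -> 'cV[R]_n,
    [/\ forall k i, a k i ord0 <= b k i ord0,
        S `<=` \bigcup_k box (a k) (b k) &
        v = (\sum_(0 <= k <oo) (\prod_i (b k i ord0 - a k i ord0))%:E)%E]].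

(* ------------------------------ Real RAM ------------------------------ *)

(* The machine has natural-number registers, used only for indexing and loop
   control, and two-dimensional arrays of reals: the cell (a, i, j) is entry
   (i, j) of array number a.  The location (a, r, s) occurring in a program
   denotes the cell (a, value of register r, value of register s), so a fixed
   program can handle inputs of every size. *)
Definition cell : Type := (nat * nat * nat)%type.
Definition loc : Type := (nat * nat * nat)%type.

Record state (R : Type) := State {
  reg : nat -> nat;
  mem : cell -> R
}.

Definition addr (R : Type) (s : state R) (l : loc) : cell :=
  (l.1.1, reg s l.1.2, reg s l.2).

Definition rd (R : Type) (s : state R) (l : loc) : R := mem s (addr s l).

Definition set_reg (R : Type) (s : state R) (d k : nat) : state R :=
  State [eta reg s with d |-> k] (mem s).

Definition set_cell (R : Type) (s : state R) (l : loc) (x : R) : state R :=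
  State (reg s) [eta mem s with addr s l |-> x].

Inductive real_op := RAdd | RSub | RMul | RDiv.

Definition real_op_defined (R : realType) (o : real_op) (y : R) : bool :=
  if o is RDiv then y != 0 else true.

Definition real_op_val (R : realType) (o : real_op) (x y : R) : R :=
  match o with
  | RAdd => x + y
  | RSub => x - y
  | RMul => x * y
  | RDiv => x / y
  end.

Inductive cmd :=
  | Skip
  | Seq (c1 c2 : cmd)
  | NatConst (d k : nat)
  | NatAdd (d r s : nat)
  | NatSub (d r s : nat)
  | RealConst (d : loc) (z : int)
  | RealMove (d x : loc)
  | RealOp (o : real_op) (d x y : loc)
  | IfNatLt (r s : nat) (c1 c2 : cmd)
  | IfRealLe (x y : loc) (c1 c2 : cmd)
  | WhileNatLt (r s : nat) (c : cmd).

(* exec c s t s': started in s, the program c halts in s' after t steps.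
   Every operation and every test, on reals or on indices, costs one step.
   Division by zero has no execution. *)
Inductive exec (R : realType) : cmd -> state R -> nat -> state R -> Prop :=
  | ExecSkip s : exec Skip s 0 s
  | ExecSeq c1 c2 s s1 s2 t1 t2 :
      exec c1 s t1 s1 -> exec c2 s1 t2 s2 -> exec (Seq c1 c2) s (t1 + t2)%N s2
  | ExecNatConst d k s : exec (NatConst d k) s 1 (set_reg s d k)
  | ExecNatAdd d p q s :
      exec (NatAdd d p q) s 1 (set_reg s d (reg s p + reg s q)%N)
  | ExecNatSub d p q s :
      exec (NatSub d p q) s 1 (set_reg s d (reg s p - reg s q)%N)
  | ExecRealConst d z s : exec (RealConst d z) s 1 (set_cell s d z%:~R)
  | ExecRealMove d x s : exec (RealMove d x) s 1 (set_cell s d (rd s x))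
  | ExecRealOp o d x y s :
      real_op_defined o (rd s y) ->
      exec (RealOp o d x y) s 1
        (set_cell s d (real_op_val o (rd s x) (rd s y)))
  | ExecIfNatLt p q c1 c2 s t s' :
      exec (if (reg s p < reg s q)%N then c1 else c2) s t s' ->
      exec (IfNatLt p q c1 c2) s t.+1 s'
  | ExecIfRealLe x y c1 c2 s t s' :
      exec (if rd s x <= rd s y then c1 else c2) s t s' ->
      exec (IfRealLe x y c1 c2) s t.+1 s'
  | ExecWhileStop p q c s :
      (reg s p < reg s q)%N = false -> exec (WhileNatLt p q c) s 1 s
  | ExecWhileStep p q c s s1 s2 t1 t2 :
      (reg s p < reg s q)%N ->
      exec c s t1 s1 -> exec (WhileNatLt p q c) s1 t2 s2 ->
      exec (WhileNatLt p q c) s (t1 + t2).+1%N s2.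

Lemma exec_det (R : realType) (c : cmd) (s : state R) (t : nat) (s1 : state R) :
  exec c s t s1 -> forall t' s2, exec c s t' s2 -> t = t' /\ s1 = s2.
Proof.
elim=> {c s t s1}.
- by move=> s t' s2 H; inversion H.
- move=> c1 c2 s s1 s2 t1 t2 _ I1 _ I2 t' s' H; inversion H; subst.
  match goal with H: exec c1 _ _ _ |- _ => have [-> E] := I1 _ _ H end; subst.
  by match goal with H: exec c2 _ _ _ |- _ => have [-> E] := I2 _ _ H end; subst.
1-5: by move=> *; match goal with H : exec _ _ _ _ |- _ => inversion H end.
- by move=> o d x y s _ t' s' H; inversion H.
- by move=> ? ? ? ? ? ? ? _ I ? ? H; inversion H; subst; match goal with H: exec (if _ then _ else _) _ _ _ |- _ => have [-> ->] := I _ _ H end.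
- by move=> ? ? ? ? ? ? ? _ I ? ? H; inversion H; subst; match goal with H: exec (if _ then _ else _) _ _ _ |- _ => have [-> ->] := I _ _ H end.
- by move=> p q c s E t' s' H; inversion H; subst=> //; congruence.
- move=> p q c s s1 s2 t1 t2 E _ I1 _ I2 t' s' H; inversion H; subst; first congruence.
  match goal with H: exec c _ _ _ |- _ => have [-> Es] := I1 _ _ H end; subst.
  by match goal with H: exec (WhileNatLt _ _ _) _ _ _ |- _ => have [-> Es] := I2 _ _ H end; subst.
Qed.

Definition entry (R : realType) (p q : nat) (M : 'M[R]_(p, q)) (i j : nat) : R :=
  match insub i, insub j with
  | Some i', Some j' => M i' j'
  | _, _ => 0
  end.

(* Registers 0 and 1 hold m and n, array 0 holds A, row 0 of array 1 holds
   lambda; everything else is zero. *)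
Definition input (R : realType) (m n : nat) (A : 'M[R]_(m, n))
    (lambda : 'rV[R]_m) : state R :=
  State
    (fun r => match r with 0 => m | 1 => n | _ => 0 end)%N
    (fun u => match u.1.1 with
              | 0%N => entry A u.1.2 u.2
              | 1%N => entry lambda u.1.2 u.2
              | _ => 0
              end).

(* The output matrix is read from array 2. *)
Definition output (R : realType) (n : nat) (s : state R) : 'M[R]_n :=
  \matrix_(i, j) mem s (2, val i, val j)%N.

(* Main.v *)
Require Import Defs.
From mathcomp Require Import all_boot all_order all_algebra.
From mathcomp Require Import all_classical all_reals all_analysis.
From mathcomp Require Import ring lra zify.

Set Implicit Arguments.
Unset Strict Implicit.
Unset Printing Implicit Defensive.

Import Order.TTheory GRing.Theory Num.Theory.
Local Open Scope classical_set_scope.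
Local Open Scope ring_scope.

(* For a sign vector c put s = A c. The fourth moment method gives a c with
   sum_i lambda_i |s_i| >= 9/16, and conditional expectations find it in time
   O(mn). As sum_i lambda_i s_i = (lambda A) c is at most 1/12 in absolute
   value, the partial combination v of the lambda_i A_i with s_i >= 0 satisfies
   v . c >= 23/96, hence |v| >= (23/96) / sqrt n. On the other hand,
   0 <= v . x <= |lambda A| <= 1/(12 n) for all x in both P and B. So their
   intersection lies in a slab of width O(1/sqrt n), and
   F = I + v v^T / |v|^2, of determinant 2, maps it into the ball of radius
   1 + 1/(5n). Shrinking back loses at most the factor 5/4, so the volume grows
   by a factor of at least 8/5. *)

(** * Outer volume under linear maps *)

(** Box covers directly yield only upper bounds vol(f(S)) <= k vol(S), but these need no
    measurability. The lower bound on the volume of F(P) inside B is therefore obtained by applying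
    one to the inverse of F, followed by the factor 1 + 1/(5n). The expectation of |s_i| over the
    undecided signs has no cheap formula. A quartic below |y| replaces it: its second and fourth
    moments are controlled by the current s_i and the remaining variance alone, so each sign costs
    O(m). The powers of n just balance. A sign vector has length sqrt n, so |lambda A| |c| stays
    below a small constant, and the same sqrt n is what |v| loses. A slab of width O(1/sqrt n) lets
    the stretch add O(1/n) to |x|^2, and the n-th power of 1 + O(1/n) is bounded. *)

Definition box_vol (R : realType) (n : nat) (a b : 'cV[R]_n) : R :=
  \prod_i (b i ord0 - a i ord0).

Lemma box_vol_ge0 (R : realType) (n : nat) (a b : 'cV[R]_n) :
  (forall i, a i ord0 <= b i ord0) -> 0 <= box_vol a b.
Proof. by move=> ab; apply: prodr_ge0 => i _; rewrite subr_ge0. Qed.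

Lemma vol_ge0 (R : realType) (n : nat) (S : set 'cV[R]_n) : (0 <= vol S)%E.
Proof.
apply: le_ereal_inf_tmp => _ [a [b [ab _ ->]]].
by apply: nneseries_ge0 => k _ _; rewrite lee_fin; exact: box_vol_ge0.
Qed.

Lemma le_vol (R : realType) (n : nat) (S T : set 'cV[R]_n) :
  S `<=` T -> (vol S <= vol T)%E.
Proof.
move=> ST; apply: ereal_inf_le_tmp => _ [a [b [ab TU ->]]].
by exists a, b; split => //; exact: subset_trans TU.
Qed.

Lemma vol_finite_cover (R : realType) (n : nat) (S : set 'cV[R]_n.+1) (N : nat)
    (a b : nat -> 'cV[R]_n.+1) :
  (forall k i, (k < N)%N -> a k i ord0 <= b k i ord0) ->
  S `<=` \bigcup_(k in `I_N) box (a k) (b k) ->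
  (vol S <= (\sum_(k < N) box_vol (a k) (b k))%:E)%E.
Proof.
move=> ab SU.
(* Padding by the box {0} costs nothing because the dimension is positive; in dimension 0 the empty
   product would give it volume 1. *)
pose tr (c : nat -> 'cV[R]_n.+1) k := if (k < N)%N then c k else 0.
have trab k i : tr a k i ord0 <= tr b k i ord0.
  by rewrite /tr; case: ifP => // kN; exact: ab.
apply: ereal_inf_lbound; exists (tr a), (tr b); split=> //.
  move=> x /SU [k /= kN xk]; exists k => //.
  by rewrite /tr kN.
rewrite (nneseries_split _ N) => [|k _]; last first.
  by rewrite lee_fin; exact: box_vol_ge0.
rewrite eseries0 => [|k]; last first.
  rewrite add0n leqNgt => kN _; congr (_%:E).
  by rewrite (bigD1 ord0)//= /tr (negbTE kN) subrr mul0r.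
rewrite adde0 add0n big_mkord sumEFin; congr (_%:E).
by apply: eq_bigr => k _; rewrite /tr ltn_ord.
Qed.

Lemma vol_le_box (R : realType) (n : nat) (S : set 'cV[R]_n.+1)
    (a b : 'cV[R]_n.+1) :
  (forall i, a i ord0 <= b i ord0) -> S `<=` box a b ->
  (vol S <= (box_vol a b)%:E)%E.
Proof.
move=> ab Sab; have := @vol_finite_cover R n S 1 (fun=> a) (fun=> b).
by rewrite big_ord1; apply=> [_ i _|x /Sab xab]; [exact: ab|exists 0%N].
Qed.

(** The usual argument with errors e / 2^(k+1): the double family of boxes is renumbered along a
    bijection of [nat] with pairs. Infinite volumes are set aside first, since near-optimal covers
    need a finite infimum. *)
Lemma vol_sigma_subadditive (R : realType) (n : nat)
    (S : nat -> set 'cV[R]_n) :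
  (vol (\bigcup_k S k) <= \sum_(k <oo) vol (S k))%E.
Proof.
have [[k koo]|] := pselect (exists k, vol (S k) = +oo%E).
  rewrite (eseries_pinfty _ _ koo) ?leey// => i _.
  by rewrite -ltNye (lt_le_trans _ (vol_ge0 _)).
rewrite -forallNE => Soo.
apply/lee_addgt0Pr => e e0.
apply: le_trans (epsilon_trick xpredT (fun k => vol_ge0 (S k)) (ltW e0)).
pose Q k (c : (nat -> 'cV[R]_n) * (nat -> 'cV[R]_n)) :=
  [/\ forall j i, c.1 j i ord0 <= c.2 j i ord0,
      S k `<=` \bigcup_j box (c.1 j) (c.2 j) &
      (\sum_(j <oo) (box_vol (c.1 j) (c.2 j))%:E <=
       vol (S k) + (e / (2 ^ k.+1)%:R)%:E)%E].
have [c Qc] : {c & forall k, Q k (c k)}.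
  apply: (@choice _ _ Q) => k.
  have fin : vol (S k) \is a fin_num.
    by rewrite ge0_fin_numE ?vol_ge0// ltey; apply/eqP.
  have ek : 0 < e / (2 ^ k.+1)%:R by rewrite divr_gt0// ltr0n expn_gt0.
  have [_ [a [b [ab SU ->]]] lt] := lb_ereal_inf_adherent ek fin.
  by exists (a, b); split=> //; exact: ltW.
pose g (q : nat * nat) : \bar R := (box_vol ((c q.1).1 q.2) ((c q.1).2 q.2))%:E.
have g0 q : (0 <= g q)%E.
  by rewrite lee_fin; apply: box_vol_ge0 => i; have [] := Qc q.1.
have /card_esym/ppcard_eqP[f] := card_nat2.
apply: (@le_trans _ _ (\sum_(k <oo) \sum_(j <oo) g (k, j))%E); last first.
  apply: lee_nneseries => [k _ _|k _]; first exact: nneseries_ge0.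
  by have [] := Qc k.
rewrite nneseries_esumT; last by move=> k; exact: nneseries_ge0.
under eq_esum do rewrite nneseries_esumT//.
rewrite esum_esum//.
apply: ereal_inf_lbound.
exists (fun l => (c (f l).1).1 (f l).2), (fun l => (c (f l).1).2 (f l).2).
split.
- by move=> l i; have [] := Qc (f l).1.
- move=> x [k _ Skx]; have [_ SU _] := Qc k; have [j _ xj] := SU _ Skx.
  by exists (f^-1%FUN (k, j)) => //; rewrite invK ?inE.
- rewrite (nneseries_esumT (fun l => g0 (f l))).
  rewrite (reindex_esum setT _ f).
    by apply: eq_esum => l _; rewrite -surjective_pairing.
  rewrite (_ : _ `*`` _ = setT); first exact: bij.
  by apply/seteqP; split.
Qed.

(** * Maps and the factor by which they enlarge outer volume *)

Definition scales_vol (R : realType) (n : nat) (k : R)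
    (f : 'cV[R]_n -> 'cV[R]_n) : Prop :=
  forall S, (vol (f @` S) <= k%:E * vol S)%E.

Lemma scales_vol_comp (R : realType) (n : nat) (k l : R)
    (f g : 'cV[R]_n -> 'cV[R]_n) :
  0 <= k -> scales_vol k f -> scales_vol l g -> scales_vol (k * l) (f \o g).
Proof.
move=> k0 fk gl S; rewrite -image_comp; apply: le_trans (fk _) _.
by rewrite EFinM -muleA; apply: lee_wpmul2l; rewrite ?lee_fin.
Qed.

(** The images of the boxes of a cover of S cover the image of S, so countable subadditivity reduces
    everything to a single box. *)
Lemma scales_vol_boxes (R : realType) (n : nat) (k : R)
    (f : 'cV[R]_n -> 'cV[R]_n) :
  0 < k ->
  (forall a b : 'cV[R]_n, (forall i, a i ord0 <= b i ord0) ->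
     (vol (f @` box a b) <= (k * box_vol a b)%:E)%E) ->
  scales_vol k f.
Proof.
move=> k0 fk S; rewrite -lee_pdivrMl//.
apply: le_ereal_inf_tmp => _ [a [b [ab SU ->]]].
rewrite lee_pdivrMl// -nneseriesZl => [|j _]; last first.
  by rewrite lee_fin; exact: box_vol_ge0.
apply: (@le_trans _ _ (vol (\bigcup_j (f @` box (a j) (b j))))).
  by apply: le_vol => _ [x /SU[j _ xj] <-]; exists j.
apply: le_trans (vol_sigma_subadditive _) _.
by apply: lee_nneseries => [j _ _|j _]; [exact: vol_ge0|exact: fk].
Qed.

Lemma scales_vol_diag (R : realType) (n : nat) (d : 'I_n.+1 -> R) :
  (forall i, 0 < d i) ->
  scales_vol (\prod_i d i) (fun x => \col_i (d i * x i ord0)).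
Proof.
move=> d0; apply: scales_vol_boxes; first exact: prodr_gt0.
move=> a b ab.
rewrite /box_vol -big_split/=; under eq_bigr do rewrite mulrBr.
apply: (le_trans (@vol_le_box _ _ _ (\col_i (d i * a i ord0))
  (\col_i (d i * b i ord0)) _ _)).
- by move=> i; rewrite !mxE ler_pM2l.
- by move=> _ [x xab <-] i; rewrite !mxE !ler_pM2l.
- by rewrite lee_fin /box_vol; under eq_bigr do rewrite !mxE.
Qed.

Definition shear (R : realType) (n : nat) (i j : 'I_n) (c : R) (x : 'cV[R]_n) :=
  x + (c * x j ord0) *: delta_mx i ord0.

Lemma subdivision_point (R : realType) (l h x : R) (N : nat) :
  l <= x <= l + N.+1%:R * h ->
  exists2 t, (t < N.+1)%N & l + t%:R * h <= x <= l + t.+1%:R * h.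
Proof.
elim: N => [|N IH] /andP[lx xu].
  by exists 0%N => //; rewrite mul0r addr0 lx.
have [xN|Nx] := leP x (l + N.+1%:R * h).
  by have [|t tN xt] := IH; [rewrite lx|exists t => //; exact: ltnW].
by exists N.+1 => //; rewrite ltW.
Qed.

Lemma le_div_nat (R : realType) (x : \bar R) (v C : R) : 0 <= C ->
  (forall N, x <= (v + C / N.+1%:R)%:E)%E -> (x <= v%:E)%E.
Proof.
move=> C0 xN; apply/lee_addgt0Pr => e e0.
apply: le_trans (xN (Num.bound (C / e))) _.
rewrite -EFinD lee_fin lerD2l ler_pdivrMr// mulrC -ler_pdivrMr//.
apply: le_trans (ltW (archi_boundP _)) _; last by rewrite ler_nat.
by rewrite divr_ge0// ltW.
Qed.

(** Cut into N + 1 slices of width h across coordinate j, the box is moved almost rigidly slice by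
    slice: each image fits in a translate of the slice with side i lengthened by 2|c|h. The total
    excess is a constant over N + 1, and N is arbitrary. *)
Lemma scales_vol_shear (R : realType) (n : nat) (i j : 'I_n.+1) (c : R) :
  i != j -> scales_vol 1 (shear i j c).
Proof.
move=> ij; apply: scales_vol_boxes => // l u lu; rewrite mul1r.
pose w p := u p ord0 - l p ord0.
have w0 p : 0 <= w p by rewrite subr_ge0.
pose W := \prod_(p | (p != i) && (p != j)) w p.
have W0 : 0 <= W by apply: prodr_ge0.
have split_prod (f : 'I_n.+1 -> R) :
    \prod_p f p = f i * (f j * \prod_(p | (p != i) && (p != j)) f p).
  by rewrite (bigD1 i)//= (bigD1 j)//= eq_sym.
apply: (@le_div_nat _ _ _ (2 * `|c| * w j ^+ 2 * W)) => [|N].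
  by rewrite !mulr_ge0// exprn_ge0.
pose h := w j / N.+1%:R.
have h0 : 0 <= h by rewrite divr_ge0.
have hN : N.+1%:R * h = w j by rewrite mulrC divfK// pnatr_eq0.
pose y t := l j ord0 + t%:R * h.
pose a t : 'cV[R]_n.+1 := \col_p
  if p == i then l i ord0 + c * y t - `|c| * h else
  if p == j then y t else l p ord0.
pose b t : 'cV[R]_n.+1 := \col_p
  if p == i then u i ord0 + c * y t + `|c| * h else
  if p == j then y t.+1 else u p ord0.
have yS t : y t.+1 = y t + h by rewrite /y mulrSr mulrDl mul1r addrA.
have ch0 : 0 <= `|c| * h by rewrite mulr_ge0.
apply: (le_trans (@vol_finite_cover _ _ _ N.+1 a b _ _)).
- move=> t p _; rewrite !mxE; case: (eqVneq p i) => _.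
    by have := lu i; lra.
  by case: (eqVneq p j) => _; rewrite ?yS ?lerDl.
- move=> _ [x xlu <-].
  have [|t tN /andP[tx xt]] := @subdivision_point _ (l j ord0) h (x j ord0) N.
    by rewrite hN /w; have /andP[-> ?] := xlu j; lra.
  rewrite -/(y _) in tx; rewrite -/(y _) yS in xt.
  exists t => // p; rewrite !mxE eqxx andbT.
  case: (eqVneq p i) => [->|pi]; last first.
    rewrite mulr0 addr0; case: (eqVneq p j) => [->|_]; last exact: xlu.
    by rewrite yS tx.
  rewrite mulr1.
  have : `|c * (x j ord0 - y t)| <= `|c| * h.
    by rewrite normrM ler_wpM2l// ger0_norm; lra.
  by rewrite ler_norml => /andP[? ?]; have /andP[? ?] := xlu i; lra.
rewrite lee_fin; under eq_bigr.
  move=> t _; rewrite /box_vol split_prod !mxE eqxx (eq_sym j) (negbTE ij) eqxx.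
  under eq_bigr => p /andP[/negbTE pi /negbTE pj] do rewrite !mxE pi pj.
  rewrite yS (_ : _ * _ = (w i + 2 * `|c| * h) * h * W); last first.
    by rewrite /w /W; ring.
  over.
rewrite sumr_const card_ord -[leLHS]mulr_natl /box_vol split_prod.
rewrite -/(w i) -/(w j) -/W.
rewrite le_eqVlt; apply/orP; left; apply/eqP.
have := @pnatr_eq0 R N.+1; rewrite /h; move: (N.+1%:R) => r /negbT r0.
by field.
Qed.

Lemma scales_vol_id (R : realType) (n : nat) :
  scales_vol 1 (@id 'cV[R]_n).
Proof. by move=> S; rewrite image_id mul1e. Qed.

Lemma scales_vol_row_shear (R : realType) (n : nat) (k : 'I_n.+1)
    (w : 'I_n.+1 -> R) (s : seq 'I_n.+1) :
  k \notin s ->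
  scales_vol 1 (fun x => x + (\sum_(j <- s) w j * x j ord0) *: delta_mx k ord0).
Proof.
elim: s => [_|j s IH].
  have := @scales_vol_id R n.+1; congr scales_vol; apply/funext => x.
  by rewrite big_nil scale0r addr0.
rewrite inE negb_or => /andP[kj ks].
have := scales_vol_comp ler01 (IH ks) (@scales_vol_shear R n k j (w j) kj).
rewrite mulr1; congr scales_vol; apply/funext => x /=.
rewrite big_cons scalerDl /shear -addrA; congr (_ + (_ + _)).
congr (_ *: _); rewrite !big_seq; apply: eq_bigr => i si.
(* The shear along j altered only coordinate k, which is not in [s], so the remaining shears still
   read the original entries of x. *)
have /negbTE ik : i != k by apply: contraNneq ks => <-.
by rewrite !mxE ik mulr0 addr0.
Qed.

Lemma scales_vol_col_shear (R : realType) (n : nat) (k : 'I_n.+1)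
    (u : 'I_n.+1 -> R) (s : seq 'I_n.+1) :
  k \notin s ->
  scales_vol 1 (fun x => x + x k ord0 *: \sum_(j <- s) u j *: delta_mx j ord0).
Proof.
elim: s => [_|j s IH].
  have := @scales_vol_id R n.+1; congr scales_vol; apply/funext => x.
  by rewrite big_nil scaler0 addr0.
rewrite inE negb_or => /andP[kj /IH {}IH].
rewrite eq_sym in kj.
have := scales_vol_comp ler01 IH (@scales_vol_shear R n j k (u j) kj).
rewrite mulr1; congr scales_vol; apply/funext => x /=.
rewrite big_cons scalerDr scalerA /shear [u j * _]mulrC -addrA.
by rewrite !mxE eq_sym (negbTE kj) mulr0 addr0.
Qed.

Lemma sum_scale_delta (R : realType) (n : nat) (u : 'I_n -> R) (s : seq 'I_n)
    (i : 'I_n) : uniq s ->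
  (\sum_(j <- s) u j *: delta_mx j ord0 : 'cV_n) i ord0 =
  if i \in s then u i else 0.
Proof.
move=> us; rewrite summxE; case: ifPn => si.
  rewrite (bigD1_seq i)//= !mxE !eqxx mulr1 big1 ?addr0// => j ji.
  by rewrite !mxE eq_sym (negbTE ji) mulr0.
rewrite big1_seq// => j /= sj.
have /negbTE ij : i != j by apply: contraNneq si => ->.
by rewrite !mxE ij mulr0.
Qed.

(* Changing the coordinate of index k to the linear form w, where w k = 1,
   turns the map into a column shear followed by a diagonal scaling. *)
Lemma scales_vol_rank1 (R : realType) (n : nat) (v : 'cV[R]_n.+1) (r : R) :
  v != 0 -> 0 < r ->
  scales_vol (r ^+ n.+1 / 2) (fun x => r *:
    (x - ((\sum_i v i ord0 * x i ord0) / (2 * \sum_i v i ord0 ^+ 2)) *: v)).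
Proof.
move=> v0 r0.
have [k vk] : exists k, v k ord0 != 0.
  apply: contra_notP (elimN eqP v0) => /forallNP h; apply/colP => i.
  by rewrite !mxE; apply: contra_notP (h i) => /eqP.
pose N := \sum_i v i ord0 ^+ 2; rewrite -/N.
have N0 : N != 0.
  apply: lt0r_neq0; rewrite /N (bigD1 k)//= ltr_pwDl//; last first.
    exact: sumr_ge0 (fun i _ => sqr_ge0 _).
  by rewrite exprn_even_gt0.
pose w i := v i ord0 / v k ord0.
pose s := [seq i <- index_enum 'I_n.+1 | i != k].
have ks : k \notin s by rewrite mem_filter eqxx.
pose d i := if i == k then r / 2 else r.
have d0 i : 0 < d i by rewrite /d; case: ifP => // _; rewrite divr_gt0.
have prod_d : \prod_i d i = r ^+ n.+1 / 2.
  rewrite (bigD1 k)//= /d eqxx (eq_bigr (fun=> r)) => [|i /negbTE ->//].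
  by rewrite prodr_const cardC1 card_ord exprS mulrAC.
have key (x : 'cV[R]_n.+1) : \sum_i v i ord0 * x i ord0 =
    v k ord0 * (x k ord0 + \sum_(j <- s) w j * x j ord0).
  rewrite mulrDr big_filter mulr_sumr (bigD1 k)//=; congr (_ + _).
  by apply: eq_bigr => i _; rewrite /w mulrA [v k _ * _]mulrC divfK.
(* With W = w.x as coordinate k one has v.x = v_k W. Removing half of the v-component then shears
   the other coordinates by multiples of W ([E2]) and halves W itself, whence r / 2 in [d]; [E3]
   returns to the original coordinate. *)
have E1 := @scales_vol_row_shear R n k w s ks.
have E2 := @scales_vol_col_shear R n k
  (fun j => - (v j ord0 * v k ord0 / (2 * N))) s ks.
have E3 := @scales_vol_row_shear R n k (fun j => - w j) s ks.
have E4 := scales_vol_diag d0.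
have d_ge0 : 0 <= \prod_i d i by rewrite ltW// prodr_gt0.
have := scales_vol_comp ler01 E3
  (scales_vol_comp d_ge0 E4 (scales_vol_comp ler01 E2 E1)).
rewrite mul1r !mulr1 prod_d; congr scales_vol; apply/funext => x /=.
rewrite key; set W := x k ord0 + _.
set y1 := x + _.
have y1E i : y1 i ord0 = if i == k then W else x i ord0.
  by rewrite !mxE andbT; case: eqP => [->|_]; rewrite ?mulr1// mulr0 addr0.
rewrite y1E eqxx; set y2 := y1 + _.
have y2E i : y2 i ord0 =
    if i == k then W else x i ord0 - v i ord0 * v k ord0 / (2 * N) * W.
  rewrite mxE y1E mxE sum_scale_delta ?filter_uniq ?index_enum_uniq//.
  rewrite mem_filter mem_index_enum andbT; case: eqP => _/=.
    by rewrite mulr0 addr0.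
  by rewrite mulrN mulrC.
set y3 := \col_i _.
have y3E i : y3 i ord0 = if i == k then r / 2 * W
    else r * (x i ord0 - v i ord0 * v k ord0 / (2 * N) * W).
  by rewrite mxE y2E /d; case: ifP.
have NE : N = v k ord0 ^+ 2 + v k ord0 * \sum_(j <- s) w j * v j ord0.
  have := key v; rewrite mulrDr => <-.
  by rewrite /N; under eq_bigr do rewrite expr2.
have sumE : \sum_(j <- s) - w j * y3 j ord0 =
    - (r * (W - x k ord0 -
      (\sum_(j <- s) w j * v j ord0) * (v k ord0 / (2 * N) * W))).
  rewrite {1}/W [x k _ + _]addrC addrK mulr_suml -sumrB mulr_sumr -sumrN.
  rewrite !big_seq; apply: eq_bigr => j.
  rewrite mem_filter => /andP[/negbTE jk _].
  by rewrite y3E jk; ring.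
apply/colP => i; rewrite [LHS]mxE y3E sumE !mxE andbT.
case: (eqVneq i k) => [->|_]; last by rewrite mulr0 addr0; field.
have -> : \sum_(j <- s) w j * v j ord0 = (N - v k ord0 ^+ 2) / v k ord0.
  by rewrite NE; field.
by rewrite mulr1; field; rewrite N0 vk.
Qed.

(** * The slab and its stretching *)

Lemma cauchy_schwarz (R : realFieldType) (I : finType) (x y : I -> R) :
  (\sum_i x i * y i) ^+ 2 <= (\sum_i x i ^+ 2) * \sum_i y i ^+ 2.
Proof.
set p := \sum_i x i * y i; set X := \sum_i x i ^+ 2; set Y := \sum_i y i ^+ 2.
have Y0 : 0 <= Y by apply: sumr_ge0 => i _; exact: sqr_ge0.
have [Y_eq0|Yn0] := eqVneq Y 0.
  have y0 i : y i = 0.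
    apply/eqP; rewrite -sqrf_eq0; apply/eqP.
    by apply: (psumr_eq0P (fun j _ => sqr_ge0 (y j)) Y_eq0).
  by rewrite /p big1 ?expr0n ?Y_eq0 ?mulr0// => i _; rewrite y0 mulr0.
have Ygt0 : 0 < Y by rewrite lt0r Yn0.
rewrite -subr_ge0 -(pmulr_rge0 _ Ygt0).
have -> : Y * (X * Y - p ^+ 2) = \sum_i (x i * Y - y i * p) ^+ 2.
  rewrite [RHS](eq_bigr (fun i => Y ^+ 2 * x i ^+ 2 - 2 * Y * p * (x i * y i)
    + p ^+ 2 * y i ^+ 2)) => [|i _]; last by ring.
  by rewrite big_split sumrB -!mulr_sumr -/X -/p -/Y/=; ring.
by apply: sumr_ge0 => i _; exact: sqr_ge0.
Qed.

Lemma norm2_sqr (R : realType) (p q : nat) (v : 'M[R]_(p, q)) :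
  norm2 v ^+ 2 = \sum_i \sum_j v i j ^+ 2.
Proof.
by rewrite sqr_sqrtr//; do 2 apply: sumr_ge0 => ? _; exact: sqr_ge0.
Qed.

Lemma norm2_ge0 (R : realType) (p q : nat) (v : 'M[R]_(p, q)) : 0 <= norm2 v.
Proof. exact: sqrtr_ge0. Qed.

Lemma norm2Z (R : realType) (p q : nat) (a : R) (v : 'M[R]_(p, q)) :
  norm2 (a *: v) = `|a| * norm2 v.
Proof.
rewrite /norm2 -sqrtr_sqr -sqrtrM ?sqr_ge0// mulr_sumr; congr Num.sqrt.
apply: eq_bigr => i _; rewrite mulr_sumr; apply: eq_bigr => j _.
by rewrite mxE exprMn.
Qed.

(** A bound on powers without the exponential: n y = 1/5 gives (1 + y)^n <= 5/4. The induction rests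
    on (1 + y)(1 - (n+1) y) <= 1 - n y. *)
Lemma expr1D_le (R : realFieldType) (y : R) (n : nat) : 0 <= y ->
  (1 + y) ^+ n * (1 - n%:R * y) <= 1.
Proof.
move=> y0; elim: n => [|n IH]; first by rewrite mul0r subr0 mulr1.
apply: le_trans IH; rewrite exprSr -mulrA ler_wpM2l ?exprn_ge0 ?addr_ge0//.
rewrite -subr_ge0 mulrSr (_ : _ - _ = (n%:R + 1) * y ^+ 2); last by ring.
by rewrite mulr_ge0 ?addr_ge0 ?sqr_ge0.
Qed.

(** The quartic touches |y| at |y| = 2, hence the square in the factorization. For second moment 1
    and fourth moment 3, contact at sqrt 3 would be optimal and give 1/sqrt 3; contact at 2 keeps
    the coefficients rational and still gives 9/16. *)
Lemma abs_ge_quartic (R : realFieldType) (y : R) :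
  3 / 4 * y ^+ 2 - y ^+ 4 / 16 <= `|y|.
Proof.
have -> : y ^+ 4 = `|y| ^+ 4 by rewrite -normrX ger0_norm// exprn_even_ge0.
rewrite -(real_normK (num_real y)) -subr_ge0.
have -> : `|y| - (3 / 4 * `|y| ^+ 2 - `|y| ^+ 4 / 16) =
  `|y| * ((`|y| - 2) ^+ 2 * (`|y| + 4) / 16) by field.
apply: mulr_ge0 => //; apply: divr_ge0 => //; apply: mulr_ge0.
  exact: sqr_ge0.
by rewrite addr_ge0.
Qed.

(* Pessimistic estimator: an upper bound 3 for the fourth moment of a Rademacher
   sum of variance 1 turns 3/4 y^2 - y^4/16 <= |y| into 9/16 <= E|y|; here s is
   the partial sum already fixed and u the variance already spent. *)
Definition estimator (R : realFieldType) (s u : R) : R :=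
  3 / 4 * (s ^+ 2 + (1 - u)) -
  (s ^+ 4 + 6 * s ^+ 2 * (1 - u) + 3 * (1 - u) ^+ 2) / 16.

(** Four times the coefficient of the new sign in the change of [estimator]; here [u] is the
    variance spent after the step. *)
Definition gain (R : realFieldType) (s a u : R) : R :=
  (3 - s ^+ 2 - a ^+ 2 + 3 * u) * s * a.

(** [estimator] treats the undecided part as a Gaussian of variance 1 - u. Replacing a Gaussian term
    of fourth moment 3 a^4 by a sign term of fourth moment a^4 frees 2 a^4 / 16; only the part odd
    in e depends on the choice. *)
Lemma estimator_step (R : realFieldType) (s u a e : R) : e ^+ 2 = 1 ->
  estimator (s + e * a) (u + a ^+ 2) =
  estimator s u + a ^+ 4 / 8 + e * gain s a (u + a ^+ 2) / 4.
Proof.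
move=> e2.
have e4 : e ^+ 4 = 1 by rewrite (exprM e 2 2) e2 expr1n.
have e3 : e ^+ 3 = e by rewrite exprS e2 mulr1.
rewrite /estimator /gain.
have -> : (s + e * a) ^+ 2 = s ^+ 2 + 2 * e * s * a + a ^+ 2.
  transitivity (s ^+ 2 + 2 * e * s * a + e ^+ 2 * a ^+ 2); first by ring.
  by rewrite e2 mul1r.
have -> : (s + e * a) ^+ 4 = s ^+ 4 + 4 * e * s ^+ 3 * a
    + 6 * s ^+ 2 * a ^+ 2 + 4 * e * s * a ^+ 3 + a ^+ 4.
  transitivity (s ^+ 4 + 4 * e * s ^+ 3 * a + 6 * s ^+ 2 * e ^+ 2 * a ^+ 2
    + 4 * e ^+ 3 * s * a ^+ 3 + e ^+ 4 * a ^+ 4); first by ring.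
  by rewrite e2 e3 e4; ring.
by field.
Qed.

Lemma estimator_init (R : realFieldType) : estimator 0 0 = 9 / 16 :> R.
Proof. by rewrite /estimator; field. Qed.

Lemma estimator_final (R : realFieldType) (s : R) : estimator s 1 <= `|s|.
Proof.
apply: le_trans (abs_ge_quartic s); rewrite /estimator subrr; lra.
Qed.

(** * The positive combination v and the stretch along it *)

Definition pos_comb (R : realType) (m n : nat) (A : 'M[R]_(m, n))
    (lambda : 'rV[R]_m) (c : 'cV[R]_n) : 'cV[R]_n :=
  \col_k \sum_(i | 0 <= (A *m c) i ord0) lambda ord0 i * A i k.

Definition stretch (R : realType) (n : nat) (v : 'cV[R]_n) : 'M[R]_n :=
  \matrix_(i, j) (v i ord0 * v j ord0 / (\sum_k v k ord0 ^+ 2) + (i == j)%:R).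

Section Rescaling.
Variables (R : realType) (m n : nat) (A : 'M[R]_(m, n.+1)) (lambda : 'rV[R]_m).
Variable c : 'cV[R]_n.+1.
Hypothesis lambda_ge0 : forall i, 0 <= lambda ord0 i.
Hypothesis lambdaA_small :
  norm2 (lambda *m A) <= 1 / (12 * n.+1%:R * Num.sqrt pi).
Hypothesis c_sign : forall j, c j ord0 ^+ 2 = 1.
Hypothesis c_large : 9 / 16 <= \sum_i lambda ord0 i * `|(A *m c) i ord0|.

Let v := pos_comb A lambda c.
Let N := \sum_k v k ord0 ^+ 2.
Let d : R := n.+1%:R.

Let d_gt0 : 0 < d. Proof. exact: ltr0Sn. Qed.

Let lambdaA_bound : \sum_j (lambda *m A) ord0 j ^+ 2 <= 1 / (12 * d) ^+ 2.
Proof.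
have := norm2_sqr (lambda *m A); rewrite big_ord1 => <-.
have -> : 1 / (12 * d) ^+ 2 = (1 / (12 * d)) ^+ 2 by rewrite expr_div_n expr1n.
rewrite ler_pXn2r ?nnegrE ?norm2_ge0 ?divr_ge0 ?mulr_ge0 ?(ltW d_gt0)//.
apply: le_trans lambdaA_small _; rewrite !div1r lef_pV2 ?posrE.
- rewrite ler_peMr ?mulr_ge0 ?(ltW d_gt0)//.
  by rewrite -[leLHS]sqrtr1 ler_sqrt ?pi_gt0// (le_trans _ (pi_ge2 R))// ler1n.
- by rewrite !mulr_gt0 ?sqrtr_gt0 ?pi_gt0.
- by rewrite mulr_gt0.
Qed.

Let lambdaAx (x : 'cV[R]_n.+1) :
  (\sum_i lambda ord0 i * (A *m x) i ord0) ^+ 2 <=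
  1 / (12 * d) ^+ 2 * \sum_j x j ord0 ^+ 2.
Proof.
have -> : \sum_i lambda ord0 i * (A *m x) i ord0 =
    \sum_j (lambda *m A) ord0 j * x j ord0.
  have /(congr1 (fun M : 'M[R]_1 => M ord0 ord0)) := mulmxA lambda A x.
  by rewrite !mxE.
apply: le_trans (cauchy_schwarz _ _) _.
by rewrite ler_wpM2r// sumr_ge0// => j _; exact: sqr_ge0.
Qed.

Let vx (x : 'cV[R]_n.+1) : \sum_k v k ord0 * x k ord0 =
  \sum_(i | 0 <= (A *m c) i ord0) lambda ord0 i * (A *m x) i ord0.
Proof.
under eq_bigr do rewrite mxE mulr_suml.
rewrite exchange_big/=; apply: eq_bigr => i _; rewrite mxE mulr_sumr.
by apply: eq_bigr => k _; rewrite mulrA.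
Qed.

Let N_ge : (23 / 96) ^+ 2 / d <= N.
Proof.
set w := \sum_i lambda ord0 i * (A *m c) i ord0.
have c2 : \sum_j c j ord0 ^+ 2 = d.
  by under eq_bigr do rewrite c_sign; rewrite sumr_const card_ord.
have w_ge : - (1 / 12) <= w.
  have : w ^+ 2 <= (1 / 12) ^+ 2.
    apply: le_trans (lambdaAx c) _; rewrite c2.
    have -> : 1 / (12 * d) ^+ 2 * d = (1 / 12) ^+ 2 / d.
      by field; rewrite gt_eqF.
    by rewrite ler_pdivrMr// ler_peMr// ler1n.
  by rewrite -subr_ge0 => w2; nra.
(* The positive part of s_i is (s_i + |s_i|) / 2, and 23/96 = (9/16 - 1/12) / 2. *)
have vc : 23 / 96 <= \sum_k v k ord0 * c k ord0.
  rewrite vx.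
  suff -> : \sum_(i | 0 <= (A *m c) i ord0) lambda ord0 i * (A *m c) i ord0 =
      (w + \sum_i lambda ord0 i * `|(A *m c) i ord0|) / 2.
    by rewrite ler_pdivlMr//; apply: le_trans (lerD w_ge c_large); lra.
  rewrite -big_split/= mulr_suml big_mkcond; apply: eq_bigr => i _.
  case: (leP 0 ((A *m c) i ord0)) => s0; first by rewrite ger0_norm//; field.
  by rewrite ltr0_norm//; field.
rewrite ler_pdivrMr// -c2; apply: le_trans (cauchy_schwarz _ _).
by rewrite ler_pXn2r ?nnegrE//; lra.
Qed.

Lemma pos_comb_sqnorm_gt0 : 0 < \sum_k pos_comb A lambda c k ord0 ^+ 2.
Proof. by apply: lt_le_trans N_ge; rewrite divr_gt0// exprn_gt0// divr_gt0. Qed.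

Let N_gt0 : 0 < N := pos_comb_sqnorm_gt0.

Let stretchE (x : 'cV[R]_n.+1) :
  stretch v *m x = x + ((\sum_k v k ord0 * x k ord0) / N) *: v.
Proof.
apply/colP => i; rewrite [LHS]mxE [RHS]mxE [(_ *: v) i _]mxE.
under eq_bigr do rewrite mxE mulrDl.
rewrite big_split/= addrC; congr (_ + _).
  rewrite (bigD1 i)//= eqxx mul1r big1 ?addr0// => j /negbTE ji.
  by rewrite eq_sym ji mul0r.
by rewrite mulr_suml mulr_suml; apply: eq_bigr => j _; rewrite /N; ring.
Qed.

Let shrink (x : 'cV[R]_n.+1) :=
  x - ((\sum_k v k ord0 * x k ord0) / (2 * N)) *: v.

Let shrinkK : cancel (mulmx (stretch v)) shrink.
Proof.
move=> x; rewrite /shrink stretchE; set p := \sum_k v k ord0 * x k ord0.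
have -> : \sum_k v k ord0 * (x + (p / N) *: v) k ord0 = 2 * p.
  rewrite (eq_bigr (fun k => v k ord0 * x k ord0 + p / N * v k ord0 ^+ 2)).
    by rewrite big_split/= -mulr_sumr -/p -/N divfK ?gt_eqF//; ring.
  by move=> k _; rewrite [(x + _) _ _]mxE [(_ *: v) _ _]mxE; ring.
rewrite -addrA -scalerBl (_ : p / N - _ = 0) ?scale0r ?addr0//.
by field; rewrite gt_eqF.
Qed.

Lemma stretch_unit : stretch (pos_comb A lambda c) \in unitmx.
Proof.
rewrite -unitmx_tr -row_free_unit; apply: inj_row_free => x xF.
have : stretch v *m x^T = stretch v *m 0.
  by rewrite mulmx0 -[LHS]trmxK trmx_mul trmxK xF trmx0.
by move=> /(can_inj shrinkK)/(congr1 trmx); rewrite trmxK trmx0.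
Qed.

Let ball_image (x : 'cV[R]_n.+1) : cone A x -> unit_ball x ->
  norm2 (stretch v *m x) <= 1 + 1 / (5 * d).
Proof.
move=> Ax x1.
have x2 : \sum_j x j ord0 ^+ 2 <= 1.
  have := norm2_sqr x; under eq_bigr do rewrite big_ord1.
  by move=> <-; rewrite expr_le1 ?norm2_ge0.
set p := \sum_k v k ord0 * x k ord0.
have p2 : p ^+ 2 <= 1 / (12 * d) ^+ 2.
  apply: (@le_trans _ _ ((\sum_i lambda ord0 i * (A *m x) i ord0) ^+ 2)).
    have t0 i : 0 <= lambda ord0 i * (A *m x) i ord0.
      by rewrite mulr_ge0//; exact/ltW/Ax.
    have p0 : 0 <= p by rewrite /p vx sumr_ge0.
    rewrite ler_pXn2r ?nnegrE//; last exact: sumr_ge0.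
    rewrite /p vx.
    by rewrite [leRHS](bigID (fun i => 0 <= (A *m c) i ord0))/= lerDl sumr_ge0.
  by apply: le_trans (lambdaAx x) _; rewrite ler_piMr// divr_ge0// sqr_ge0.
(* The stretch adds 3 p^2 / N to |x|^2: 2 from the cross term and 1 from the square. The bounds on p
   and N give at most (192/529) / d, and 2/5 is chosen because (2/5) / d is the linear term of (1 +
   1/(5d))^2. *)
have pN : 3 * (p ^+ 2 / N) <= 2 / 5 / d.
  rewrite mulrA ler_pdivrMr//.
  apply: (@le_trans _ _ (2 / 5 / d * ((23 / 96) ^+ 2 / d))); last first.
    by rewrite ler_wpM2l// !divr_ge0// ltW.
  apply: (@le_trans _ _ (3 * (1 / (12 * d) ^+ 2))); first by rewrite ler_pM2l.
  rewrite (_ : 3 * _ = 1 / 48 * (1 / d ^+ 2)); last by field; rewrite gt_eqF.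
  rewrite (_ : 2 / 5 / _ * _ = 529 / 23040 * (1 / d ^+ 2)); last first.
    by field; rewrite gt_eqF.
  by rewrite ler_wpM2r ?divr_ge0 ?sqr_ge0//; lra.
have r0 : 0 <= 1 + 1 / (5 * d) by rewrite addr_ge0// divr_ge0// mulr_ge0// ltW.
rewrite -(@ler_pXn2r _ 2) ?nnegrE ?norm2_ge0// norm2_sqr stretchE -/p.
under eq_bigr do rewrite big_ord1.
have -> : \sum_i (x + (p / N) *: v) i ord0 ^+ 2 =
    \sum_i x i ord0 ^+ 2 + 3 * (p ^+ 2 / N).
  rewrite (eq_bigr (fun i => x i ord0 ^+ 2 + 2 * (p / N) * (v i ord0 * x i ord0)
    + (p / N) ^+ 2 * v i ord0 ^+ 2)) => [|i _]; last first.
    by rewrite [(x + _) _ _]mxE [(_ *: v) _ _]mxE; ring.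
  rewrite !big_split/= -!mulr_sumr -/p -/N; field.
  by rewrite gt_eqF.
have -> : (1 + 1 / (5 * d)) ^+ 2 = 1 + (2 / 5 / d + (1 / (5 * d)) ^+ 2).
  by field; rewrite gt_eqF.
by rewrite lerD// (le_trans pN)// lerDl sqr_ge0.
Qed.

Lemma stretch_vol :
  ((3 / 2)%:E * vol (cone A `&` @unit_ball R n.+1) <=
   vol ([set stretch (pos_comb A lambda c) *m x | x in cone A] `&`
        @unit_ball R n.+1))%E.
Proof.
pose r := 1 + 1 / (5 * d).
have r0 : 0 < r by rewrite addr_gt0// divr_gt0// mulr_gt0.
have rn : r ^+ n.+1 <= 5 / 4.
  have : (1 - 1 / 5) * r ^+ n.+1 <= 1.
    have := @expr1D_le R (1 / (5 * d)) n.+1.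
    rewrite -/d -/r (_ : d * (1 / (5 * d)) = 1 / 5); last first.
      by field; rewrite gt_eqF.
    by rewrite (mulrC (r ^+ _)); apply; rewrite divr_ge0 ?mulr_ge0 ?ltW.
  by move: (r ^+ n.+1) => y; lra.
have v0 : v != 0.
  apply: contraTneq N_gt0 => v0; rewrite /N big1 ?ltxx// => k _.
  by rewrite v0 mxE expr0n.
pose S := cone A `&` @unit_ball R n.+1.
pose S' := [set stretch v *m x | x in cone A] `&` @unit_ball R n.+1.
rewrite -/S -/S'.
(* Dividing by r brings the stretched point back into the ball and, P being a cone, keeps it in the
   image of P. *)
have SS' : S `<=` (fun x => r *: shrink x) @` S'.
  move=> x [Ax x1]; exists (r^-1 *: (stretch v *m x)).
    split.
      exists (r^-1 *: x); last by rewrite -scalemxAr.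
      by move=> i; rewrite -scalemxAr mxE mulr_gt0 ?invr_gt0.
    rewrite /unit_ball/= norm2Z gtr0_norm ?invr_gt0// mulrC ler_pdivrMr// mul1r.
    exact: ball_image.
  by rewrite scalemxAr shrinkK scalerA divff ?scale1r// gt_eqF.
apply: (@le_trans _ _ ((3 / 2)%:E * ((r ^+ n.+1 / 2)%:E * vol S'))%E).
  apply: lee_wpmul2l; first by rewrite lee_fin divr_ge0.
  by apply: le_trans (le_vol SS') _; exact: scales_vol_rank1.
(* The factor is at most (3/2)(5/8) = 15/16. *)
rewrite muleA -EFinM -[leRHS]mul1e; apply: lee_wpmul2r; first exact: vol_ge0.
by rewrite lee_fin; move: (r ^+ n.+1) rn => y; lra.
Qed.

End Rescaling.

(** * Program logic for the real RAM *)

Fixpoint wreg (c : cmd) : seq nat :=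
  match c with
  | Seq c1 c2 | IfNatLt _ _ c1 c2 | IfRealLe _ _ c1 c2 => wreg c1 ++ wreg c2
  | NatConst d _ | NatAdd d _ _ | NatSub d _ _ => [:: d]
  | WhileNatLt _ _ c => wreg c
  | _ => [::]
  end.

Fixpoint warr (c : cmd) : seq nat :=
  match c with
  | Seq c1 c2 | IfNatLt _ _ c1 c2 | IfRealLe _ _ c1 c2 => warr c1 ++ warr c2
  | RealConst d _ | RealMove d _ | RealOp _ d _ _ => [:: d.1.1]
  | WhileNatLt _ _ c => warr c
  | _ => [::]
  end.

(** Arrays are framed as a whole, because which of their cells a command writes depends on the
    registers. *)
Definition frame (R : realType) (c : cmd) (s s' : state R) : Prop :=
  (forall r, r \notin wreg c -> reg s' r = reg s r) /\
  (forall a i j, a \notin warr c ->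
    Defs.mem s' (a, i, j) = Defs.mem s (a, i, j)).

Lemma mem_set_cell (R : realType) (s : state R) (l : loc) (x : R)
    (a i j : nat) :
  Defs.mem (set_cell s l x) (a, i, j) =
  if [&& a == l.1.1, i == reg s l.1.2 & j == reg s l.2] then x
  else Defs.mem s (a, i, j).
Proof. by rewrite /= /addr !xpair_eqE andbA. Qed.

Lemma mem_set_diff (R : realType) (s : state R) (l : loc) (x : R)
    (a i j : nat) :
  a != l.1.1 -> Defs.mem (set_cell s l x) (a, i, j) = Defs.mem s (a, i, j).
Proof. by rewrite mem_set_cell => /negbTE ->. Qed.

Lemma rd_same (R : realType) (s : state R) (l : loc) (x : R) :
  rd (set_cell s l x) l = x.
Proof. by rewrite /rd /= /addr eqxx. Qed.

Lemma rd_diff (R : realType) (s : state R) (l l' : loc) (x : R) :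
  l'.1.1 != l.1.1 -> rd (set_cell s l x) l' = rd s l'.
Proof. exact: mem_set_diff. Qed.

Lemma frame_set_reg (R : realType) (c : cmd) (d k : nat) (s : state R) :
  d \in wreg c -> frame c s (set_reg s d k).
Proof.
by move=> dc; split=> // r rc /=; case: eqVneq rc => // ->; rewrite dc.
Qed.

Lemma frame_set_cell (R : realType) (c : cmd) (d : loc) (x : R) (s : state R) :
  d.1.1 \in warr c -> frame c s (set_cell s d x).
Proof.
move=> dc; split=> // a i j ac; apply: mem_set_diff.
by apply: contraNneq ac => ->.
Qed.

Lemma frame_refl (R : realType) (c : cmd) (s : state R) : frame c s s.
Proof. by []. Qed.

Lemma frame_trans (R : realType) (c : cmd) (s1 s2 s3 : state R) :
  frame c s1 s2 -> frame c s2 s3 -> frame c s1 s3.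
Proof.
by move=> [r12 m12] [r23 m23]; split=> *; rewrite ?r23 ?m23 ?r12 ?m12.
Qed.

Lemma frame_sub (R : realType) (c c' : cmd) (s s' : state R) :
  {subset wreg c <= wreg c'} -> {subset warr c <= warr c'} ->
  frame c s s' -> frame c' s s'.
Proof.
move=> rc ac [fr fa]; split=> [r|a i j] h.
  by apply: fr; apply: contra h => /rc.
by apply: fa; apply: contra h => /ac.
Qed.

Lemma exec_frame (R : realType) (c : cmd) (s s' : state R) (t : nat) :
  exec c s t s' -> frame c s s'.
Proof.
elim=> {c s t s'}.
- by move=> s; exact: frame_refl.
- move=> c1 c2 s s1 s2 t1 t2 _ f1 _ f2; apply: (@frame_trans _ _ _ s1).
    by apply: frame_sub f1 => x /=; rewrite mem_cat => ->.
  by apply: frame_sub f2 => x /=; rewrite mem_cat orbC => ->.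
- by move=> *; apply: frame_set_reg; rewrite mem_head.
- by move=> *; apply: frame_set_reg; rewrite mem_head.
- by move=> *; apply: frame_set_reg; rewrite mem_head.
- by move=> *; apply: frame_set_cell; rewrite mem_head.
- by move=> *; apply: frame_set_cell; rewrite mem_head.
- by move=> *; apply: frame_set_cell; rewrite mem_head.
- move=> p q c1 c2 s t s' _ f; apply: frame_sub f; case: ifP => _ x /=;
    by rewrite mem_cat => ->; rewrite ?orbT.
- move=> p q c1 c2 s t s' _ f; apply: frame_sub f; case: ifP => _ x /=;
    by rewrite mem_cat => ->; rewrite ?orbT.
- by move=> *; exact: frame_refl.
- by move=> p q c s s1 s2 t1 t2 _ _ f1 _ f2; exact: frame_trans f1 f2.
Qed.

(** Termination, time and result at once. Postconditions see only the memory; the registers needed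
    later are recovered from [frame]. *)
Definition wp (R : realType) (c : cmd) (t : nat) (s : state R)
    (Q : (cell -> R) -> Prop) : Prop :=
  exists t' s', [/\ exec c s t' s', (t' <= t)%N & Q (Defs.mem s')].

Lemma wp_weaken (R : realType) (c : cmd) (t t' : nat) (s : state R)
    (Q Q' : (cell -> R) -> Prop) :
  (t <= t')%N -> (forall u, Q u -> Q' u) -> wp c t s Q -> wp c t' s Q'.
Proof.
move=> tt' QQ' [t1 [s1 [e le q]]]; exists t1, s1; split=> //; last exact: QQ'.
exact: leq_trans tt'.
Qed.

Lemma wp_frame (R : realType) (c : cmd) (t : nat) (s : state R)
    (Q : (cell -> R) -> Prop) :
  wp c t s Q -> wp c t s (fun u => Q u /\
    forall a i j, a \notin warr c -> u (a, i, j) = Defs.mem s (a, i, j)).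
Proof.
move=> [t' [s' [e le q]]]; exists t', s'; split=> //; split=> // a i j.
exact: (exec_frame e).2.
Qed.

Lemma wp_skip (R : realType) (s : state R) (Q : (cell -> R) -> Prop) :
  Q (Defs.mem s) -> wp Skip 0 s Q.
Proof. by exists 0%N, s; split=> //; exact: ExecSkip. Qed.

Lemma wp_seq (R : realType) (c1 c2 : cmd) (t1 t2 : nat) (s : state R)
    (P Q : (cell -> R) -> Prop) :
  wp c1 t1 s P ->
  (forall s1, frame c1 s s1 -> P (Defs.mem s1) -> wp c2 t2 s1 Q) ->
  wp (Seq c1 c2) (t1 + t2) s Q.
Proof.
move=> [t1' [s1 [e1 l1 p]]] h.
have [t2' [s2 [e2 l2 q]]] := h _ (exec_frame e1) p.
exists (t1' + t2')%N, s2; split=> //; last exact: leq_add.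
exact: ExecSeq e1 e2.
Qed.

Lemma wp_const (R : realType) (d : loc) (z : int) (s : state R)
    (Q : (cell -> R) -> Prop) :
  Q (Defs.mem (set_cell s d z%:~R)) -> wp (RealConst d z) 1 s Q.
Proof.
by exists 1%N, (set_cell s d z%:~R); split=> //; exact: ExecRealConst.
Qed.

Lemma wp_op (R : realType) (o : real_op) (d x y : loc) (s : state R)
    (Q : (cell -> R) -> Prop) :
  real_op_defined o (rd s y) ->
  Q (Defs.mem (set_cell s d (real_op_val o (rd s x) (rd s y)))) ->
  wp (RealOp o d x y) 1 s Q.
Proof.
move=> oy q; exists 1%N, (set_cell s d (real_op_val o (rd s x) (rd s y))).
by split=> //; exact: ExecRealOp.
Qed.

Lemma wp_const_seq (R : realType) (d : loc) (z : int) (c : cmd) (t : nat)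
    (s : state R) (Q : (cell -> R) -> Prop) :
  wp c t (set_cell s d z%:~R) Q -> wp (Seq (RealConst d z) c) t.+1 s Q.
Proof.
move=> [t' [s' [e le q]]]; exists t'.+1, s'; split=> //.
exact: ExecSeq (ExecRealConst _ _ _) e.
Qed.

Lemma wp_op_seq (R : realType) (o : real_op) (d x y : loc) (c : cmd) (t : nat)
    (s : state R) (Q : (cell -> R) -> Prop) :
  real_op_defined o (rd s y) ->
  wp c t (set_cell s d (real_op_val o (rd s x) (rd s y))) Q ->
  wp (Seq (RealOp o d x y) c) t.+1 s Q.
Proof.
move=> oy [t' [s' [e le q]]]; exists t'.+1, s'; split=> //.
exact: ExecSeq (ExecRealOp _ _ oy) e.
Qed.

Lemma wp_if_le (R : realType) (x y : loc) (c1 c2 : cmd) (t : nat)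
    (s : state R) (Q : (cell -> R) -> Prop) :
  (rd s x <= rd s y -> wp c1 t s Q) -> (rd s y < rd s x -> wp c2 t s Q) ->
  wp (IfRealLe x y c1 c2) t.+1 s Q.
Proof.
move=> h1 h2.
have [t' [s' [e le q]]] : wp (if rd s x <= rd s y then c1 else c2) t s Q.
  by case: leP.
by exists t'.+1, s'; split=> //; exact: ExecIfRealLe.
Qed.

(* Register 5 is assumed to hold 1. *)
Definition for_loop (r b : nat) (body : cmd) : cmd :=
  Seq (NatConst r 0) (WhileNatLt r b (Seq body (NatAdd r r 5%N))).

(** Each round pays for the body, a test and an increment; the last 2 pay for the initialisation and
    the failing test. The body writes neither counter, bound nor register 5, so the number of rounds
    is fixed at the start. *)
Lemma wp_for (R : realType) (r b : nat) (body : cmd) (t : nat) (s : state R)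
    (inv : nat -> (cell -> R) -> Prop) :
  r \notin [:: b; 5%N] -> ~~ has (mem (wreg body)) [:: r; b; 5%N] ->
  reg s 5 = 1%N ->
  inv 0%N (Defs.mem s) ->
  (forall k s1, (k < reg s b)%N -> reg s1 r = k ->
     frame (for_loop r b body) s s1 -> inv k (Defs.mem s1) ->
     wp body t s1 (inv k.+1)) ->
  wp (for_loop r b body) (reg s b * (t + 2) + 2) s (inv (reg s b)).
Proof.
rewrite !inE negb_or => /andP[rb r5] /=.
rewrite orbF !negb_or => /and3P[rc bc c5] s5 inv0 step.
pose W := WhileNatLt r b (Seq body (NatAdd r r 5%N)).
suff loop d k s1 : (d + k = reg s b)%N -> reg s1 r = k ->
    frame (for_loop r b body) s s1 -> inv k (Defs.mem s1) ->
    wp W (d * (t + 2) + 1) s1 (inv (reg s b)).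
  have [||||t' [s' [e le q]]] := loop (reg s b) 0%N (set_reg s r 0).
  - by rewrite addn0.
  - by rewrite /= eqxx.
  - by apply: frame_set_reg; rewrite mem_head.
  - exact: inv0.
  exists t'.+1, s'; split=> //; last by lia.
  exact: ExecSeq (ExecNatConst _ _ _) e.
elim: d k s1 => [|d IH] k s1 dk s1r fs inv_k.
  have s1b : reg s1 b = reg s b.
    apply: fs.1.
    by rewrite /= inE mem_cat !inE (eq_sym b) (negbTE rb) (negbTE bc).
  exists 1%N, s1; split=> //; last by rewrite -dk.
  by apply: ExecWhileStop; rewrite s1b s1r -dk ltnn.
have kb : (k < reg s b)%N by lia.
have keep q : q != r -> q \notin wreg body -> reg s1 q = reg s q.
  move=> /negbTE qr /negbTE qc; apply: fs.1.
  by rewrite /= inE mem_cat !inE qr qc.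
have [t1 [s2 [e1 l1 inv_k1]]] := step _ _ kb s1r fs inv_k.
have f12 := exec_frame e1.
have s25 : reg s2 5 = 1%N by rewrite f12.1// keep// eq_sym.
have s2r : reg s2 r = k by rewrite f12.1.
pose s3 := set_reg s2 r k.+1.
have e3 : exec (NatAdd r r 5) s2 1 s3.
  by have := ExecNatAdd r r 5 s2; rewrite s25 s2r addn1.
have [||||t2 [s' [e2 l2 q]]] := IH k.+1 s3.
- by lia.
- by rewrite /= eqxx.
- apply: frame_trans fs _; apply: (@frame_trans _ _ _ s2).
    apply: frame_sub f12 => x xc /=; last by rewrite mem_cat xc.
    by rewrite inE mem_cat xc orbT.
  by apply: frame_set_reg; rewrite mem_head.
- exact: inv_k1.
exists (t1 + 1 + t2).+1, s'; split=> //; last by lia.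
apply: ExecWhileStep e2; last exact: ExecSeq e1 e3.
by rewrite s1r keep// eq_sym.
Qed.

(** * The rescaling program *)

(* Registers: 2 and 3 are loop counters, 5 holds 1, 6 holds 0.
   Arrays: 3 the partial sums s_i, 4 the spent variances u_i, 5 the vector v,
   6 the total gain, 7 and 8 scratch, 9 the current sign, 10 zero, 11 |v|^2,
   12 one. *)
Definition gain_body : cmd :=
  (Seq (RealOp RMul (7, 6, 6) (0, 3, 2) (0, 3, 2))
  (Seq (RealOp RAdd (4, 3, 6) (4, 3, 6) (7, 6, 6))
  (Seq (RealConst (8, 6, 6) 3%R)
  (Seq (RealOp RSub (8, 6, 6) (8, 6, 6) (7, 6, 6))
  (Seq (RealOp RMul (7, 6, 6) (3, 3, 6) (3, 3, 6))
  (Seq (RealOp RSub (8, 6, 6) (8, 6, 6) (7, 6, 6))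
  (Seq (RealOp RAdd (8, 6, 6) (8, 6, 6) (4, 3, 6))
  (Seq (RealOp RAdd (8, 6, 6) (8, 6, 6) (4, 3, 6))
  (Seq (RealOp RAdd (8, 6, 6) (8, 6, 6) (4, 3, 6))
  (Seq (RealOp RMul (8, 6, 6) (8, 6, 6) (3, 3, 6))
  (Seq (RealOp RMul (8, 6, 6) (8, 6, 6) (0, 3, 2))
  (Seq (RealOp RMul (8, 6, 6) (8, 6, 6) (1, 6, 3))
       (RealOp RAdd (6, 6, 6) (6, 6, 6) (8, 6, 6))))))))))))))%N.

Definition update_body : cmd :=
  (Seq (RealOp RMul (7, 6, 6) (9, 6, 6) (0, 3, 2))
       (RealOp RAdd (3, 3, 6) (3, 3, 6) (7, 6, 6)))%N.

(** Two passes over the rows are needed: all s_i share one sign, known only once the weighted gains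
    are totalled. The variances do not depend on it and already advance in the first pass. *)
Definition sign_body : cmd :=
  (Seq (RealConst (6, 6, 6) 0%R)
  (Seq (for_loop 3 0 gain_body)
  (Seq (IfRealLe (10, 6, 6) (6, 6, 6)
         (RealConst (9, 6, 6) 1%R) (RealConst (9, 6, 6) (-1)%R))
       (for_loop 3 0 update_body))))%N.

Definition add_row_body : cmd :=
  (Seq (RealOp RMul (7, 6, 6) (1, 6, 3) (0, 3, 2))
       (RealOp RAdd (5, 2, 6) (5, 2, 6) (7, 6, 6)))%N.

Definition sqnorm_body : cmd :=
  (Seq (RealOp RMul (7, 6, 6) (5, 2, 6) (5, 2, 6))
       (RealOp RAdd (11, 6, 6) (11, 6, 6) (7, 6, 6)))%N.

Definition entry_body : cmd :=
  (Seq (RealOp RMul (7, 6, 6) (5, 3, 6) (5, 2, 6))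
       (RealOp RDiv (2, 3, 2) (7, 6, 6) (11, 6, 6)))%N.

Definition rescaling_program : cmd :=
  (Seq (NatConst 5 1)
  (Seq (for_loop 2 1 sign_body)
  (Seq (for_loop 3 0
         (IfRealLe (10, 6, 6) (3, 3, 6) (for_loop 2 1 add_row_body) Skip))
  (Seq (for_loop 2 1 sqnorm_body)
  (Seq (RealConst (12, 6, 6) 1%R)
       (for_loop 3 1
         (Seq (for_loop 2 1 entry_body)
              (RealOp RAdd (2, 3, 3) (2, 3, 3) (12, 6, 6)))))))))%N.

(** * Correctness and running time of the loops *)

Section Correctness.
Variables (R : realType) (m n : nat) (a : nat -> nat -> R) (l : nat -> R).

(** What no loop disturbs. The data are total functions on [nat], so no index bounds are carried
    along. *)
Definition base (s : state R) : Prop :=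
  [/\ reg s 0 = m, reg s 1 = n, reg s 5 = 1 & reg s 6 = 0]%N /\
  [/\ forall i j, Defs.mem s (0, i, j)%N = a i j,
      forall i, Defs.mem s (1, 0, i)%N = l i &
      Defs.mem s (10, 0, 0)%N = 0].

Lemma base_frame (c : cmd) (s s' : state R) :
  ~~ has (mem (wreg c)) [:: 0; 1; 5; 6]%N ->
  ~~ has (mem (warr c)) [:: 0; 1; 10]%N ->
  frame c s s' -> base s -> base s'.
Proof.
rewrite /= !orbF !negb_or => /and4P[c0 c1 c5 c6] /and3P[d0 d1 d10] [fr fa].
move=> [[s0 s1 s5 s6] [m0 m1 m10]].
by split; split=> *; rewrite ?fr ?fa.
Qed.

Lemma gain_loop (s : state R) (k : nat) (S U : nat -> R) :
  base s -> reg s 2 = k ->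
  (forall i, (i < m)%N -> Defs.mem s (3, i, 0)%N = S i) ->
  (forall i, (i < m)%N -> Defs.mem s (4, i, 0)%N = U i) ->
  Defs.mem s (6, 0, 0)%N = 0 ->
  wp (for_loop 3 0 gain_body) (m * 15 + 2) s (fun u =>
    (forall i, (i < m)%N -> u (4, i, 0)%N = U i + a i k ^+ 2) /\
    u (6, 0, 0)%N = \sum_(i < m) l i * gain (S i) (a i k) (U i + a i k ^+ 2)).
Proof.
move=> bs sk sS sU sG.
pose inv p (u : cell -> R) :=
  (forall i, (i < m)%N ->
     u (4, i, 0)%N = if (i < p)%N then U i + a i k ^+ 2 else U i) /\
  u (6, 0, 0)%N = \sum_(i < p) l i * gain (S i) (a i k) (U i + a i k ^+ 2).
have [[s0 s1 s5 s6] _] := bs.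
have := @wp_for R 3 0 gain_body 13 s inv; rewrite s0 => loop.
apply: wp_weaken (loop _ _ _ _ _) => // [u [uU uG]||p t pm tp fr [tU tG]].
- by split=> // i im; rewrite uU// im.
- by split=> [i im|]; rewrite ?big_ord0// sU.
have bt : base t by apply: base_frame fr bs.
have [[t0 t1 t5 t6] [tA tL _]] := bt.
have t2 : reg t 2 = k by rewrite fr.1.
have rA : rd t (0, 3, 2)%N = a p k by rewrite /rd /addr /= tp t2 tA.
have rL : rd t (1, 6, 3)%N = l p by rewrite /rd /addr /= tp t6 tL.
have rS : rd t (3, 3, 6)%N = S p by rewrite /rd /addr /= tp t6 fr.2// sS.
have rU : rd t (4, 3, 6)%N = U p by rewrite /rd /addr /= tp t6 tU// ltnn.
have rG : rd t (6, 6, 6)%N = Defs.mem t (6, 0, 0)%N by rewrite /rd /addr /= t6.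
do 2! (apply: wp_op_seq => //;
  rewrite ?(rd_same, rd_diff)//= ?(rA, rL, rS, rU, rG)).
apply: wp_const_seq.
do 9! (apply: wp_op_seq => //;
  rewrite ?(rd_same, rd_diff)//= ?(rA, rL, rS, rU, rG)).
apply: wp_op => //; rewrite ?(rd_same, rd_diff)// ?(rA, rL, rS, rU, rG).
split=> [i im|]; rewrite !mem_set_cell /= ?tp ?t6 ?eqxx ?andbT /=.
  rewrite ltnS leq_eqVlt; case: eqVneq => [->|_]//=; exact: tU.
by rewrite tG big_ord_recr /=; congr (_ + _); rewrite /gain; ring.
Qed.

Definition signs (c : nat -> R) : Prop := forall j, c j ^+ 2 = 1.

Definition partial_sums (c : nat -> R) (k i : nat) : R :=
  \sum_(j < k) c j * a i j.

Definition partial_variance (k i : nat) : R := \sum_(j < k) a i j ^+ 2.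

(** Past signs are not stored by the program, so [c] is existential. It is defined at every index,
    which makes fixing the next sign a mere overwriting at k. *)
Definition sign_inv (k : nat) (u : cell -> R) : Prop :=
  exists c : nat -> R, [/\ signs c,
    forall i, (i < m)%N -> u (3, i, 0)%N = partial_sums c k i,
    forall i, (i < m)%N -> u (4, i, 0)%N = partial_variance k i &
    9 / 16 <= \sum_(i < m) l i *
      estimator (partial_sums c k i) (partial_variance k i)].

Lemma update_loop (s : state R) (k : nat) (S : nat -> R) (e : R) :
  base s -> reg s 2 = k ->
  (forall i, (i < m)%N -> Defs.mem s (3, i, 0)%N = S i) ->
  Defs.mem s (9, 0, 0)%N = e ->
  wp (for_loop 3 0 update_body) (m * 4 + 2) s (fun u =>
    forall i, (i < m)%N -> u (3, i, 0)%N = S i + e * a i k).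
Proof.
move=> bs sk sS se.
pose inv p (u : cell -> R) := forall i, (i < m)%N ->
  u (3, i, 0)%N = if (i < p)%N then S i + e * a i k else S i.
have [[s0 s1 s5 s6] _] := bs.
have := @wp_for R 3 0 update_body 2 s inv; rewrite s0 => loop.
apply: wp_weaken (loop _ _ _ _ _) => // [u uS i im|p t pm tp fr tS].
  by rewrite uS// im.
have bt : base t by apply: base_frame fr bs.
have [[t0 t1 t5 t6] [tA tL _]] := bt.
have t2 : reg t 2 = k by rewrite fr.1.
have rA : rd t (0, 3, 2)%N = a p k by rewrite /rd /addr /= tp t2 tA.
have rE : rd t (9, 6, 6)%N = e by rewrite /rd /addr /= t6 fr.2.
have rS : rd t (3, 3, 6)%N = S p by rewrite /rd /addr /= tp t6 tS// ltnn.
apply: wp_op_seq => //; rewrite ?(rd_same, rd_diff)//= ?(rA, rE, rS).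
apply: wp_op => //; rewrite ?(rd_same, rd_diff)// ?(rA, rE, rS).
move=> i im; rewrite !mem_set_cell /= ?tp ?t6 ?eqxx ?andbT /=.
by rewrite ltnS leq_eqVlt; case: eqVneq => [->|_]//=; exact: tS.
Qed.

Lemma partial_sums_extend (c : nat -> R) (e : R) (k i : nat) :
  partial_sums (fun j => if j == k then e else c j) k.+1 i =
  partial_sums c k i + e * a i k.
Proof.
rewrite /partial_sums big_ord_recr /= eqxx; congr (_ + _).
by apply: eq_bigr => j _; rewrite ltn_eqF.
Qed.

Lemma partial_varianceS (k i : nat) :
  partial_variance k.+1 i = partial_variance k i + a i k ^+ 2.
Proof. exact: big_ord_recr. Qed.

Lemma sign_step (s : state R) (k : nat) :
  (forall i, 0 <= l i) -> base s -> reg s 2 = k -> sign_inv k (Defs.mem s) ->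
  wp sign_body (m * 19 + 7) s (sign_inv k.+1).
Proof.
move=> l0 bs sk [c [cs sS sU est]].
have -> : (m * 19 + 7 = (m * 15 + 2 + (2 + (m * 4 + 2))).+1)%N by lia.
set S := partial_sums c k in sS est; set U := partial_variance k in sU est.
pose G := \sum_(i < m) l i * gain (S i) (a i k) (U i + a i k ^+ 2).
have [[_ _ _ s6] _] := bs.
apply: wp_const_seq; set t := set_cell _ _ _.
have ft : frame sign_body s t by exact: frame_set_cell.
have bt : base t by apply: base_frame ft bs.
apply: wp_seq.
  apply: (@gain_loop t k S U) => //.
  by rewrite mem_set_cell /= s6.
move=> t1 f1 [u1 g1].
have b1 : base t1 by apply: base_frame f1 bt.
have [[_ _ _ t16] [_ _ t1z]] := b1.
apply: (@wp_seq _ _ _ _ _ _ (fun u => exists e,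
    [/\ e ^+ 2 = 1, 0 <= e * G & u (9, 0, 0)%N = e])).
  have rz : rd t1 (10, 6, 6)%N = 0 by rewrite /rd /addr /= t16.
  have rG : rd t1 (6, 6, 6)%N = G by rewrite /rd /addr /= t16.
  apply: wp_if_le; rewrite rz rG => G0; apply: wp_const.
    by exists 1; rewrite expr1n mul1r mem_set_cell /= t16.
  by exists (- 1); rewrite sqrrN expr1n mulN1r oppr_ge0 mem_set_cell /= t16 ltW.
move=> t2 f2 [e [e2 eG ue]].
have b2 : base t2 by apply: base_frame f2 b1.
have t2k : reg t2 2 = k by rewrite f2.1// f1.1.
have t2S i : (i < m)%N -> Defs.mem t2 (3, i, 0)%N = S i.
  by move=> im; rewrite f2.2// f1.2//; exact: sS.
apply: wp_weaken (wp_frame (update_loop b2 t2k t2S ue)) => // u [uS ufr].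
exists (fun j => if j == k then e else c j); split=> [j|i im|i im|].
- by case: ifP.
- by rewrite uS// partial_sums_extend.
- by rewrite ufr// f2.2// u1// partial_varianceS.
apply: le_trans est _.
have -> : \sum_(i < m) l i * estimator
      (partial_sums (fun j => if j == k then e else c j) k.+1 i)
      (partial_variance k.+1 i) =
    \sum_(i < m) l i * estimator (S i) (U i) +
    (\sum_(i < m) l i * (a i k ^+ 4 / 8) + e * G / 4).
  rewrite /G mulr_sumr mulr_suml -!big_split /=; apply: eq_bigr => i _.
  rewrite partial_sums_extend partial_varianceS estimator_step//.
  by rewrite -/(S i) -/(U i); ring.
(* The even contributions are fourth powers and e was chosen with e G >= 0, so the weighted
   estimator cannot drop. *)
rewrite lerDl addr_ge0 ?divr_ge0// sumr_ge0// => i _.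
by rewrite mulr_ge0 ?divr_ge0 ?exprn_even_ge0.
Qed.

Lemma sign_loop (s : state R) :
  (forall i, 0 <= l i) -> \sum_(i < m) l i = 1 -> base s ->
  (forall i, Defs.mem s (3, i, 0)%N = 0) ->
  (forall i, Defs.mem s (4, i, 0)%N = 0) ->
  wp (for_loop 2 1 sign_body) (n * (m * 19 + 9) + 2) s (sign_inv n).
Proof.
move=> l0 l1 bs s3 s4.
have [[s0 s1 s5 s6] _] := bs.
have := @wp_for R 2 1 sign_body (m * 19 + 7) s sign_inv; rewrite s1 => loop.
apply: wp_weaken (loop _ _ _ _ _) => //; first by rewrite -addnA.
  (* Any signs do here, since empty partial sums read none of them; each estimator starts at 9/16
     and the weights sum to 1. *)
  exists (fun=> 1); split=> [j|i _|i _|].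
  - by rewrite expr1n.
  - by rewrite s3 /partial_sums big_ord0.
  - by rewrite s4 /partial_variance big_ord0.
  rewrite /partial_sums /partial_variance.
  under eq_bigr do rewrite !big_ord0 estimator_init.
  by rewrite -mulr_suml l1 mul1r.
move=> k t kn tk fr.
by apply: sign_step => //; exact: base_frame fr bs.
Qed.

Lemma add_row_loop (s : state R) (p : nat) (V : nat -> R) :
  base s -> reg s 3 = p ->
  (forall k, (k < n)%N -> Defs.mem s (5, k, 0)%N = V k) ->
  wp (for_loop 2 1 add_row_body) (n * 4 + 2) s (fun u =>
    forall k, (k < n)%N -> u (5, k, 0)%N = V k + l p * a p k).
Proof.
move=> bs sp sV.
pose inv q (u : cell -> R) := forall k, (k < n)%N ->
  u (5, k, 0)%N = if (k < q)%N then V k + l p * a p k else V k.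
have [[s0 s1 s5 s6] _] := bs.
have := @wp_for R 2 1 add_row_body 2 s inv; rewrite s1 => loop.
apply: wp_weaken (loop _ _ _ _ _) => // [u uV k kn|q t qn tq fr tV].
  by rewrite uV// kn.
have bt : base t by apply: base_frame fr bs.
have [[t0 t1 t5 t6] [tA tL _]] := bt.
have t3 : reg t 3 = p by rewrite fr.1.
have rA : rd t (0, 3, 2)%N = a p q by rewrite /rd /addr /= tq t3 tA.
have rL : rd t (1, 6, 3)%N = l p by rewrite /rd /addr /= t6 t3 tL.
have rV : rd t (5, 2, 6)%N = V q by rewrite /rd /addr /= tq t6 tV// ltnn.
apply: wp_op_seq => //; rewrite ?(rd_same, rd_diff)//= ?(rA, rL, rV).
apply: wp_op => //; rewrite ?(rd_same, rd_diff)// ?(rA, rL, rV).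
move=> k kn; rewrite !mem_set_cell /= ?tq ?t6 ?eqxx ?andbT /=.
by rewrite ltnS leq_eqVlt; case: eqVneq => [->|_]//=; exact: tV.
Qed.

Lemma combination_loop (s : state R) (S : nat -> R) :
  base s -> (forall i, (i < m)%N -> Defs.mem s (3, i, 0)%N = S i) ->
  (forall k, Defs.mem s (5, k, 0)%N = 0) ->
  wp (for_loop 3 0
       (IfRealLe (10, 6, 6)%N (3, 3, 6)%N (for_loop 2 1 add_row_body) Skip))
    (m * (n * 4 + 5) + 2) s (fun u =>
    forall k, (k < n)%N ->
      u (5, k, 0)%N = \sum_(i < m | 0 <= S i) l i * a i k).
Proof.
move=> bs sS s5z.
pose inv p (u : cell -> R) := forall k, (k < n)%N ->
  u (5, k, 0)%N = \sum_(i < p | 0 <= S i) l i * a i k.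
have [[s0 s1 s5 s6] _] := bs.
have := @wp_for R 3 0 (IfRealLe (10, 6, 6)%N (3, 3, 6)%N
  (for_loop 2 1 add_row_body) Skip) (n * 4 + 3) s inv; rewrite s0 => loop.
apply: wp_weaken (loop _ _ _ _ _) => //.
- by rewrite -addnA.
- by move=> k kn; rewrite big_ord0.
move=> p t pm tp fr tV.
have bt : base t by apply: base_frame fr bs.
have [[t0 t1 t5 t6] [tA tL tz]] := bt.
have rz : rd t (10, 6, 6)%N = 0 by rewrite /rd /addr /= t6.
have rS : rd t (3, 3, 6)%N = S p by rewrite /rd /addr /= tp t6 fr.2// sS.
rewrite [(_ + 3)%N]addnS; apply: wp_if_le; rewrite rz rS => Sp.
  apply: wp_weaken (add_row_loop bt tp tV) => // u uV k kn.
  by rewrite uV// [RHS]big_mkcond big_ord_recr /= Sp -big_mkcond.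
apply: wp_weaken (wp_skip _) => //; [exact: (fun u (h : inv p.+1 u) => h)|].
move=> k kn; rewrite tV// [RHS]big_mkcond big_ord_recr /= leNgt Sp addr0.
by rewrite -big_mkcond.
Qed.

Lemma sqnorm_loop (s : state R) (V : nat -> R) :
  base s -> (forall k, (k < n)%N -> Defs.mem s (5, k, 0)%N = V k) ->
  Defs.mem s (11, 0, 0)%N = 0 ->
  wp (for_loop 2 1 sqnorm_body) (n * 4 + 2) s (fun u =>
    u (11, 0, 0)%N = \sum_(k < n) V k ^+ 2).
Proof.
move=> bs sV sN.
pose inv q (u : cell -> R) := u (11, 0, 0)%N = \sum_(k < q) V k ^+ 2.
have [[s0 s1 s5 s6] _] := bs.
have := @wp_for R 2 1 sqnorm_body 2 s inv; rewrite s1 => loop.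
apply: wp_weaken (loop _ _ _ _ _) => //; first by rewrite /inv big_ord0.
move=> q t qn tq fr tN.
have bt : base t by apply: base_frame fr bs.
have [[t0 t1 t5 t6] _] := bt.
have rV : rd t (5, 2, 6)%N = V q by rewrite /rd /addr /= tq t6 fr.2// sV.
have rN : rd t (11, 6, 6)%N = \sum_(k < q) V k ^+ 2 by rewrite /rd /addr /= t6.
apply: wp_op_seq => //; rewrite ?(rd_same, rd_diff)//= ?(rV, rN).
apply: wp_op => //; rewrite ?(rd_same, rd_diff)// ?(rV, rN).
by rewrite /inv mem_set_cell /= t6 big_ord_recr /= expr2.
Qed.

(** The frame cannot separate rows of array 2, so the second conjunct is what protects the rows
    already computed. *)
Lemma entry_loop (s : state R) (i : nat) (V : nat -> R) (N : R) :
  base s -> reg s 3 = i -> (i < n)%N ->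
  (forall k, (k < n)%N -> Defs.mem s (5, k, 0)%N = V k) ->
  Defs.mem s (11, 0, 0)%N = N -> N != 0 ->
  wp (for_loop 2 1 entry_body) (n * 4 + 2) s (fun u =>
    (forall k, (k < n)%N -> u (2, i, k)%N = V i * V k / N) /\
    (forall j k, j != i -> u (2, j, k)%N = Defs.mem s (2, j, k)%N)).
Proof.
move=> bs si in_ sV sN N0.
pose inv q (u : cell -> R) :=
  (forall k, (k < q)%N -> u (2, i, k)%N = V i * V k / N) /\
  (forall j k, j != i -> u (2, j, k)%N = Defs.mem s (2, j, k)%N).
have [[s0 s1 s5 s6] _] := bs.
have := @wp_for R 2 1 entry_body 2 s inv; rewrite s1 => loop.
apply: wp_weaken (loop _ _ _ _ _) => //.
move=> q t qn tq fr [tF tF'].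
have bt : base t by apply: base_frame fr bs.
have [[t0 t1 t5 t6] _] := bt.
have t3 : reg t 3 = i by rewrite fr.1.
have rVi : rd t (5, 3, 6)%N = V i by rewrite /rd /addr /= t3 t6 fr.2// sV.
have rVq : rd t (5, 2, 6)%N = V q by rewrite /rd /addr /= tq t6 fr.2// sV.
have rN : rd t (11, 6, 6)%N = N by rewrite /rd /addr /= t6 fr.2.
apply: wp_op_seq => //; rewrite ?(rd_same, rd_diff)//= ?(rVi, rVq, rN).
apply: wp_op => //; rewrite ?(rd_same, rd_diff)// ?(rVi, rVq, rN)//.
split=> [k|j k ji]; rewrite !mem_set_cell /= ?t3 ?tq ?eqxx /=.
  by rewrite ltnS leq_eqVlt; case: eqVneq => [->|_]//=; exact: tF.
by rewrite (negbTE ji) tF'.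
Qed.

Lemma matrix_loop (s : state R) (V : nat -> R) (N : R) :
  base s ->
  (forall k, (k < n)%N -> Defs.mem s (5, k, 0)%N = V k) ->
  Defs.mem s (11, 0, 0)%N = N -> N != 0 ->
  Defs.mem s (12, 0, 0)%N = 1 ->
  wp (for_loop 3 1
       (Seq (for_loop 2 1 entry_body)
            (RealOp RAdd (2, 3, 3)%N (2, 3, 3)%N (12, 6, 6)%N)))
    (n * (n * 4 + 5) + 2) s (fun u =>
    forall i k, (i < n)%N -> (k < n)%N ->
      u (2, i, k)%N = V i * V k / N + (i == k)%:R).
Proof.
move=> bs sV sN N0 sO.
pose inv p (u : cell -> R) := forall i k, (i < p)%N -> (k < n)%N ->
  u (2, i, k)%N = V i * V k / N + (i == k)%:R.
have [[s0 s1 s5 s6] _] := bs.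
have := @wp_for R 3 1 (Seq (for_loop 2 1 entry_body)
  (RealOp RAdd (2, 3, 3)%N (2, 3, 3)%N (12, 6, 6)%N)) (n * 4 + 3) s inv.
rewrite s1 => loop.
apply: wp_weaken (loop _ _ _ _ _) => //; first by rewrite -addnA.
move=> p t pn tp fr tF.
have bt : base t by apply: base_frame fr bs.
have -> : (n * 4 + 3 = n * 4 + 2 + 1)%N by rewrite -addnA.
apply: wp_seq.
  apply: (@entry_loop t p V N) => // [k kn|]; first by rewrite fr.2// sV.
  by rewrite fr.2.
move=> t1 f1 [t1F t1F'].
have b1 : base t1 by apply: base_frame f1 bt.
have [[_ _ _ t16] _] := b1.
have t13 : reg t1 3 = p by rewrite f1.1.
have rF : rd t1 (2, 3, 3)%N = V p * V p / N by rewrite /rd /addr /= t13 t1F.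
have rO : rd t1 (12, 6, 6)%N = 1 by rewrite /rd /addr /= t16 f1.2// fr.2.
apply: wp_op => //; rewrite rF rO => i k; rewrite ltnS leq_eqVlt => ip kn.
rewrite mem_set_cell /= t13; case: (eqVneq i p) ip => [->|ip] /= ip'.
  case: (eqVneq k p) => [->//|kp].
  by rewrite t1F// addr0.
by rewrite t1F'// tF.
Qed.

End Correctness.

(** * The complete program and its guarantee *)

Lemma entry_ord (R : realType) (p q : nat) (M : 'M[R]_(p, q)) (i : 'I_p)
    (j : 'I_q) :
  entry M i j = M i j.
Proof. by rewrite /entry !valK. Qed.

Theorem lemma7 (R : realType) :
  exists (p : cmd) (c : R) (K : nat),
    1 < c /\
    forall (m n : nat) (A : 'M[R]_(m, n)) (lambda : 'rV[R]_m),
      (forall i, norm2 (row i A) = 1) ->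
      cone A !=set0 ->
      (forall i, 0 <= lambda ord0 i) ->
      norm1 lambda = 1 ->
      norm2 (lambda *m A) <= 1 / (12 * n%:R * Num.sqrt pi) ->
      exists (t : nat) (s : state R),
        [/\ exec p (input A lambda) t s,
            (t <= K * (m * n ^ 2))%N,
            output n s \in unitmx &
            (c%:E * vol (cone A `&` @unit_ball R n) <=
             vol ([set output n s *m x | x in cone A] `&` @unit_ball R n))%E].
Proof.
(* 3/2 lies below the available 8/5. The run takes at most 23mn + 4n^2 + 18n + 5m + 10 steps, whose
   coefficients add up to 60; with m, n >= 1 every monomial is at most m n^2. *)
exists rescaling_program, (3 / 2), 60%N; split; first lra.
move=> m n A lambda A1 _ l0 l1 lA.
(* m = 0 contradicts |lambda|_1 = 1, and n = 0 contradicts the unit rows. *)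
case: m A lambda A1 l0 l1 lA => [|m] A lambda A1 l0 l1 lA.
  by move: l1; rewrite /norm1 big_ord1 big_ord0 => /esym/eqP; rewrite oner_eq0.
case: n A A1 lA => [|n] A A1 lA.
  have := A1 ord0; rewrite /norm2 big_ord1 big_ord0 sqrtr0 => /esym/eqP.
  by rewrite oner_eq0.
pose a := entry A; pose l := entry lambda 0.
have lE (i : 'I_m.+1) : l i = lambda ord0 i := entry_ord lambda ord0 i.
have l_ge0 i : 0 <= l i.
  rewrite /l /entry; case: insub => // i0; case: insub => // i1.
  by rewrite [i0]ord1.
have l_sum : \sum_(i < m.+1) l i = 1.
  rewrite -l1 /norm1 big_ord1; apply: eq_bigr => i _.
  by rewrite lE ger0_norm.
(* Unit rows mean that each s_i has total variance 1, so after all n signs [estimator_final]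
   applies. *)
have sq1 (i : 'I_m.+1) : \sum_(j < n.+1) a i j ^+ 2 = 1.
  have := norm2_sqr (row i A); rewrite A1 expr1n big_ord1 => ->.
  by apply: eq_bigr => j _; rewrite mxE /a entry_ord.
pose s0 := set_reg (input A lambda) 5 1.
have b0 : base m.+1 n.+1 a l s0 by [].
have [t1 [s1 [e1 le1 [c [cs s1S _ est]]]]] :=
  sign_loop l_ge0 l_sum b0 (fun=> erefl) (fun=> erefl).
have f1 := exec_frame e1.
have b1 : base m.+1 n.+1 a l s1 by apply: base_frame f1 b0.
(* The accumulators for v and |v|^2 are never initialised; they rely on the zeros of the input
   state. *)
have z1 b : b \in [:: 5; 11]%N -> forall i j, Defs.mem s1 (b, i, j) = 0.
  by rewrite !inE => /orP[]/eqP-> i j; rewrite f1.2.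
pose S := partial_sums a c n.+1.
have [t2 [s2 [e2 le2 s2V]]] :=
  combination_loop b1 s1S (fun k => z1 5%N isT k 0%N).
have f2 := exec_frame e2.
have b2 : base m.+1 n.+1 a l s2 by apply: base_frame f2 b1.
have N0 : Defs.mem s2 (11, 0, 0)%N = 0 by rewrite f2.2// z1.
have [t3 [s3 [e3 le3 s3N]]] := sqnorm_loop b2 s2V N0.
have f3 := exec_frame e3.
have b3 : base m.+1 n.+1 a l s3 by apply: base_frame f3 b2.
pose s4 := set_cell s3 (12, 6, 6)%N 1%:~R.
have f4 := frame_set_cell (c := RealConst (12, 6, 6)%N 1)
  1%:~R s3 (mem_head _ _).
have b4 : base m.+1 n.+1 a l s4 by apply: base_frame f4 b3.
pose cv : 'cV[R]_n.+1 := \col_j c j.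
have SE i : (A *m cv) i ord0 = S i.
  by rewrite mxE; apply: eq_bigr => j _; rewrite mxE /a entry_ord mulrC.
have cv_sign j : cv j ord0 ^+ 2 = 1 by rewrite mxE.
have cv_large : 9 / 16 <= \sum_i lambda ord0 i * `|(A *m cv) i ord0|.
  apply: le_trans est _; apply: ler_sum => i _.
  by rewrite SE lE ler_wpM2l// /partial_variance sq1 estimator_final.
pose V k := \sum_(i < m.+1 | 0 <= S i) l i * a i k.
have VE (k : 'I_n.+1) : V k = pos_comb A lambda cv k ord0.
  by rewrite mxE; apply: eq_big => [i|i _]; rewrite ?SE// lE /a entry_ord.
pose N := \sum_(k < n.+1) V k ^+ 2.
have NE : N = \sum_k pos_comb A lambda cv k ord0 ^+ 2.
  by apply: eq_bigr => k _; rewrite VE.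
have N_neq0 : N != 0 by rewrite NE gt_eqF// pos_comb_sqnorm_gt0.
have s4V k : (k < n.+1)%N -> Defs.mem s4 (5, k, 0)%N = V k.
  by move=> kn; rewrite f4.2// f3.2// s2V.
have s4N : Defs.mem s4 (11, 0, 0)%N = N by rewrite f4.2.
have s4O : Defs.mem s4 (12, 0, 0)%N = 1.
  by rewrite mem_set_cell /=; have [[_ _ _ ->] _] := b3.
have [t5 [s5 [e5 le5 s5F]]] := matrix_loop b4 s4V s4N N_neq0 s4O.
have outE : output n.+1 s5 = stretch (pos_comb A lambda cv).
  apply/matrixP => i j; rewrite [LHS]mxE [RHS]mxE.
  by rewrite s5F ?ltn_ord// (VE i) (VE j) NE.
exists (1 + (t1 + (t2 + (t3 + (1 + t5)))))%N, s5; rewrite outE; split.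
- apply: ExecSeq (ExecNatConst _ _ _) _; apply: ExecSeq e1 _.
  apply: ExecSeq e2 _; apply: ExecSeq e3 _.
  exact: ExecSeq (ExecRealConst _ _ _) e5.
- move: le1 le2 le3 le5.
  have : (0 < m.+1)%N by [].
  have : (0 < n.+1)%N by [].
  move: m.+1 n.+1 => M D; nia.
- exact: stretch_unit.
- exact: stretch_vol.
Qed.
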